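(* Let $\mathfrak g$ be a nilpotent real Lie algebra of real dimension $2n\ge 6$ endowed with a quasi-nilpotent complex structure $J$, and let $2\le p<n$. If $(\mathfrak g,J)$ admits a $p$-Kähler structure, then $(\mathfrak g,J)$ is the $\mathfrak b$-extension of a $(p-1)$-Kähler nilpotent Lie algebra; that is, there exist a $2$-dimensional $J$-invariant subspace $\mathfrak b$ and a nilpotent Lie algebra with complex structure $(\mathfrak k,K)$ of real dimension $2(n-1)$ admitting a $(p-1)$-Kähler structure, such that $(\mathfrak g,J)$ is a $\mathfrak b$-extension of $(\mathfrak k,K)$.
   Context: A complex structure on a real Lie algebra $\mathfrak g$ is an endomorphism $J$ with $J^2=-\mathrm{Id}$ that is integrable (vanishing Nijenhuis tensor); $d$ denotes the Chevalley–Eilenberg differential. Quasi-nilpotent: for a complex structure $J$ on a nilpotent Lie algebra $\mathfrak g$ put $\mathfrak a_0(J)=\{0\}$ and $\mathfrak a_k(J)=\{X\in\mathfrak g: [X,\mathfrak g]\subseteq\mathfrak a_{k-1}(J),\ [JX,\mathfrak g]\subseteq\mathfrak a_{k-1}(J)\}$ for $k\ge1$. $J$ is quasi-nilpotent if $\mathfrak a_1(J)\ne\{0\}$. Note $\mathfrak a_1(J)=\zeta\cap J\zeta$, with $\zeta$ the center of $\mathfrak g$. $\mathfrak b$-extension: let $\mathfrak g$ be a nilpotent Lie algebra of real dimension $2n$ with a quasi-nilpotent complex structure $J$ and let $\mathfrak b\subseteq\mathfrak a_1(J)$ be a $J$-invariant subspace of real dimension $2$ (hence a central ideal). If $\mathfrak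 k$ is a nilpotent Lie algebra of real dimension $2(n-1)$ with a complex structure $K$ such that $(\mathfrak k,K)$ is isomorphic to $\mathfrak g/\mathfrak b$ with the complex structure induced by $J$, then $(\mathfrak g,J)$ is called a $\mathfrak b$-extension of $(\mathfrak k,K)$. Positivity. Let $V$ be a complex vector space of dimension $n$ and $\Lambda^{p,q}$ the space of $(p,q)$-forms on $V$. An $(n,n)$-form $\nu$ is positive if $\nu=c\,i\alpha^1\wedge\overline{\alpha^1}\wedge\cdots\wedge i\alpha^n\wedge\overline{\alpha^n}$ with $c\in\mathbb R_{\ge0}$ and $\{\alpha^j\}$ a basis of $\Lambda^{1,0}$; it is a volume form if $c>0$. A $(q,0)$-form is simple if it is of the form $\mu_1\wedge\dots\wedge\mu_q$ with $\mu_j\in\Lambda^{1,0}$. A $(k,k)$-form $\Omega$ is transverse if for every non-zero simple $(n-k,0)$-form $\psi$ the $(n,n)$-form $i^{(n-k)^2}\,\Omega\wedge\psi\wedge\bar\psi$ is a volume form. A $p$-Kähler structure on a Lie algebra with complex structure $(\mathfrak g,J)$ of complex dimension $n$ ($1\le p<n$) is a real transverse $(p,p)$-form $\Omega$ on $(\mathfrak g,J)$ (a complex vector space via $J$) with $d\Omega=0$. The Lie algebra is called $p$-Kähler if it admits such a structure. *)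

(* Defs.v *)
From HB Require Import structures.
From mathcomp Require Import all_boot all_order all_algebra.
From mathcomp Require Import complex reals.

Set Implicit Arguments.
Unset Strict Implicit.
Unset Printing Implicit Defensive.

Import GRing.Theory Num.Theory.

Local Open Scope ring_scope.
Local Open Scope complex_scope.
Local Open Scope quotient_scope.

HB.mixin Record isLieAlgebra (F : fieldType) (g : Type) of Vector F g := {
  lie : g -> g -> g;
  lie_linearl : forall a x y z, lie (a *: x + y) z = a *: lie x z + lie y z;
  lie_linearr : forall a x y z, lie x (a *: y + z) = a *: lie x y + lie x z;
  liexx : forall x, lie x x = 0;
  lie_jacobi : forall x y z,
    lie x (lie y z) + lie y (lie z x) + lie z (lie x y) = 0
}.

#[short(type="lieAlgType")]
HB.structure Definition LieAlgebra (F : fieldType) :=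
  { g of isLieAlgebra F g & Vector F g }.

Section LieAlgebraDefs.
Variables (F : fieldType) (g : lieAlgType F).
Implicit Types (x y : g) (U b : {vspace g}) (J : 'End(g)).

(* By bilinearity the brackets of basis vectors of [U] and [g] span [U, g]. *)
Definition lower_central (k : nat) : {vspace g} :=
  iter k (fun U => <<[seq lie x y | x <- vbasis U, y <- vbasis {:g}]>>%VS)
       fullv.

Definition lie_nilpotent : Prop := exists k, lower_central k = 0%VS.

Definition lie_ideal b : Prop := forall x y, y \in b -> lie x y \in b.

Definition nijenhuis J x y : g :=
  lie (J x) (J y) - J (lie (J x) y) - J (lie x (J y)) - lie x y.

Definition complex_structure J : Prop :=
  (forall x, J (J x) = - x) /\ (forall x y, nijenhuis J x y = 0).

Fixpoint asc J (k : nat) (x : g) : Prop :=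
  if k is k'.+1 then forall y, asc J k' (lie x y) /\ asc J k' (lie (J x) y)
  else x = 0.

Definition quasi_nilpotent J : Prop := exists2 x, asc J 1 x & x <> 0.

End LieAlgebraDefs.

Arguments lie_nilpotent {F} g.

Definition cplx_isomorphic (F : fieldType) (g k : lieAlgType F)
    (J : 'End(g)) (K : 'End(k)) : Prop :=
  exists f : 'Hom(g, k),
    [/\ bijective f, forall x y, f (lie x y) = lie (f x) (f y)
      & forall x, f (J x) = K (f x)].

Section LieQuotient.
Variables (F : fieldType) (g : lieAlgType F) (b : {vspace g}).
Hypothesis bI : lie_ideal b.

Definition lie_quot of lie_ideal b := (Quotient.quot b).
Local Notation Q := (lie_quot bI).

HB.instance Definition _ := GRing.Zmodule.on Q.

Definition lie_pi (x : g) : Q := \pi_(Quotient.quot b) x.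

Lemma lie_pi_surj (q : Q) : exists x, q = lie_pi x.
Proof. by exists (repr (q : (Quotient.quot b))); rewrite /lie_pi reprK. Qed.

Lemma lie_pi_eq x y : (lie_pi x = lie_pi y) <-> (x - y \in b).
Proof.
by split=> [|h]; [move/eqP; rewrite -Quotient.idealrBE
                 |apply/eqP; rewrite -Quotient.idealrBE].
Qed.

Lemma lie_piD x y : lie_pi (x + y) = lie_pi x + lie_pi y.
Proof. exact: (raddfD (\pi_(Quotient.quot b) : {additive g -> (Quotient.quot b)})). Qed.

Lemma lie_pi_repr x : repr (lie_pi x : (Quotient.quot b)) - x \in b.
Proof. by apply/lie_pi_eq; rewrite /lie_pi reprK. Qed.

Definition quot_scale (a : F) (q : Q) : Q := lie_pi (a *: repr (q : (Quotient.quot b))).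

Lemma quot_scale_pi a x : quot_scale a (lie_pi x) = lie_pi (a *: x).
Proof. by apply/lie_pi_eq; rewrite -scalerBr rpredZ ?lie_pi_repr. Qed.

Fact quot_scaleA a c q : quot_scale a (quot_scale c q) = quot_scale (a * c) q.
Proof. by have [x ->] := lie_pi_surj q; rewrite !quot_scale_pi scalerA. Qed.

Fact quot_scale1 : left_id 1 quot_scale.
Proof. by move=> q; have [x ->] := lie_pi_surj q; rewrite quot_scale_pi scale1r. Qed.

Fact quot_scaleDr : right_distributive quot_scale +%R.
Proof.
move=> a q r; have [x ->] := lie_pi_surj q; have [y ->] := lie_pi_surj r.
by rewrite -lie_piD !quot_scale_pi scalerDr lie_piD.
Qed.

Fact quot_scaleDl q : {morph quot_scale^~ q : a c / a + c}.
Proof.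
move=> a c; have [x ->] := lie_pi_surj q.
by rewrite !quot_scale_pi scalerDl lie_piD.
Qed.

HB.instance Definition _ := GRing.Zmodule_isLmodule.Build F Q
  quot_scaleA quot_scale1 quot_scaleDr quot_scaleDl.

Fact lie_pi_linear : linear lie_pi.
Proof. by move=> a x y; rewrite lie_piD -quot_scale_pi. Qed.

HB.instance Definition _ :=
  GRing.isLinear.Build F g Q _ lie_pi lie_pi_linear.

Lemma lie_pi_ker x : (lie_pi x == 0) = (x \in b).
Proof.
apply/eqP/idP; first by rewrite -(linear0 lie_pi) lie_pi_eq subr0.
by move=> xb; rewrite -(linear0 lie_pi); apply/lie_pi_eq; rewrite subr0.
Qed.

Fact quot_vect_iso : Vector.axiom (\dim (b^C)) Q.
Proof.
pose W := subvs_of (b^C)%VS.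
pose h (x : g) : W := vsproj (b^C)%VS (daddv_pi (b^C)%VS b x).
have tr : (b^C :&: b)%VS = 0%VS by rewrite capvC capv_compl.
have hb x : x \in b -> h x = 0.
  move=> xb; have := daddv_pi_add tr (w := x).
  rewrite addvC addv_complf memvf => /(_ isT).
  have -> : daddv_pi b (b^C) x = x by rewrite daddv_pi_id // capv_compl.
  by move/(canRL (addrK _)); rewrite subrr /h => ->; rewrite linear0.
have h_lin : linear h by move=> a x y; rewrite /h !linearP.
pose hL : {linear g -> W} :=
  HB.pack h (GRing.isLinear.Build F g W *:%R h h_lin).
have hE x y : lie_pi x = lie_pi y -> h x = h y.
  by move/lie_pi_eq/hb => hxy; apply/eqP; rewrite -subr_eq0 -(linearB hL) /= hxy.
pose phi (q : Q) : W := h (repr (q : (Quotient.quot b))).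
have phiE x : phi (lie_pi x) = h x.
  by apply: hE; apply/lie_pi_eq; exact: lie_pi_repr.
have phi_lin : linear phi.
  move=> a q r; have [x ->] := lie_pi_surj q; have [y ->] := lie_pi_surj r.
  by rewrite -linearP !phiE h_lin.
have phi_bij : bijective phi.
  exists (fun w => lie_pi (vsval w)) => [q|w]; last first.
    by rewrite phiE /h daddv_pi_id ?subvsP ?vsvalK.
  have [x ->] := lie_pi_surj q; rewrite phiE /h vsprojK ?memv_pi //.
  apply/lie_pi_eq; have := daddv_pi_add tr (w := x).
  rewrite addvC addv_complf memvf => /(_ isT) {2}<-.
  by rewrite opprD addNKr rpredN memv_pi.
have [v vl vb] := subvs_vect_iso (b^C)%VS.
exists (v \o phi); last exact: bij_comp.
by move=> a q r /=; rewrite phi_lin vl.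
Qed.

HB.instance Definition _ := Lmodule_hasFinDim.Build F Q quot_vect_iso.

Definition quot_lie (q r : Q) : Q :=
  lie_pi (lie (repr (q : (Quotient.quot b))) (repr (r : (Quotient.quot b)))).

Lemma quot_lie_pi x y : quot_lie (lie_pi x) (lie_pi y) = lie_pi (lie x y).
Proof.
apply/lie_pi_eq.
have lieC u v : lie u v = - lie v u :> g.
  have add z w t : lie (z + w) t = lie z t + lie w t :> g.
    by have := lie_linearl 1 z w t; rewrite !scale1r.
  have addr z w t : lie z (w + t) = lie z w + lie z t :> g.
    by have := lie_linearr 1 z w t; rewrite !scale1r.
  have := liexx (u + v); rewrite add !addr !liexx addr0 add0r.
  by move/eqP; rewrite addr_eq0 => /eqP.
have sub z w t : lie z w - lie z t = lie z (w - t) :> g.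
  have := lie_linearr (-1) z t w; rewrite !scaleN1r => h.
  by rewrite addrC -h addrC.
set u := repr _; set v := repr _.
rewrite -[lie u v](subrK (lie u y)) -addrA sub; apply: rpredD.
  by apply/bI/lie_pi_repr.
rewrite [lie u y]lieC [lie x y]lieC -opprD rpredN sub.
by apply/bI/lie_pi_repr.
Qed.

Fact quot_lie_linearl a (x y z : Q) :
  quot_lie (a *: x + y) z = a *: quot_lie x z + quot_lie y z.
Proof.
have [[x' ->] [y' ->]] := (lie_pi_surj x, lie_pi_surj y).
have [z' ->] := lie_pi_surj z.
by rewrite -linearP !quot_lie_pi lie_linearl linearP.
Qed.

Fact quot_lie_linearr a (x y z : Q) :
  quot_lie x (a *: y + z) = a *: quot_lie x y + quot_lie x z.
Proof.
have [[x' ->] [y' ->]] := (lie_pi_surj x, lie_pi_surj y).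
have [z' ->] := lie_pi_surj z.
by rewrite -linearP !quot_lie_pi lie_linearr linearP.
Qed.

Fact quot_liexx (x : Q) : quot_lie x x = 0.
Proof. by have [y ->] := lie_pi_surj x; rewrite quot_lie_pi liexx linear0. Qed.

Fact quot_lie_jacobi (x y z : Q) :
  quot_lie x (quot_lie y z) + quot_lie y (quot_lie z x)
    + quot_lie z (quot_lie x y) = 0.
Proof.
have [[x' ->] [y' ->]] := (lie_pi_surj x, lie_pi_surj y).
have [z' ->] := lie_pi_surj z.
by rewrite !quot_lie_pi -!linearD lie_jacobi linear0.
Qed.

HB.instance Definition _ := isLieAlgebra.Build F Q
  quot_lie_linearl quot_lie_linearr quot_liexx quot_lie_jacobi.

(* The endomorphism induced by [J]; meaningful when [b] is [J]-invariant. *)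
Definition quot_end (J : 'End(g)) : 'End(Q) :=
  linfun (fun q : Q => lie_pi (J (repr (q : (Quotient.quot b))))).

Lemma quot_endE (J : 'End(g)) x :
  (J @: b <= b)%VS -> quot_end J (lie_pi x) = lie_pi (J x).
Proof.
move=> Jb; pose h (q : Q) := lie_pi (J (repr (q : (Quotient.quot b)))).
have hE y : h (lie_pi y) = lie_pi (J y).
  apply/lie_pi_eq; rewrite -linearB; apply: (subvP Jb); apply: memv_img.
  exact: lie_pi_repr.
have h_lin : linear h.
  move=> a q r; have [u ->] := lie_pi_surj q; have [v ->] := lie_pi_surj r.
  by rewrite -linearP !hE !linearP.
pose hL : {linear Q -> Q} :=
  HB.pack h (GRing.isLinear.Build F Q Q *:%R h h_lin).
by rewrite /quot_end -/h (lfunE hL) /= hE.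
Qed.

End LieQuotient.

Definition b_extension (F : fieldType) (g : lieAlgType F) (J : 'End(g))
    (b : {vspace g}) (k : lieAlgType F) (K : 'End(k)) : Prop :=
  [/\ [/\ lie_nilpotent g, complex_structure J & quasi_nilpotent J],
      [/\ \dim b = 2, (J @: b <= b)%VS & forall x, x \in b -> asc J 1 x],
      [/\ lie_nilpotent k, complex_structure K
        & exists n, \dim {:g} = n.*2 /\ \dim {:k} = (n - 1).*2]
    & exists bI : lie_ideal b, cplx_isomorphic (quot_end bI J) K].

(* A (possibly inhomogeneous) form is encoded by its values on all lists of
   vectors: its component of degree [k] is its restriction to the lists of
   length [k], and it is homogeneous of degree [k] when it vanishes on all
   other lists. This avoids casts between types indexed by the degree. *)
Definition extform (R : realType) (V : Type) := seq V -> R[i].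

Section Forms.
Variables (R : realType) (V : Type).
Implicit Types (a w : extform R V).

Definition form_one : extform R V := fun s => (nilp s)%:R.

Definition form_of1 (mu : V -> R[i]) : extform R V :=
  fun s => if s is [:: x] then mu x else 0.

Definition form_scale (c : R[i]) w : extform R V := fun s => c * w s.

Definition form_conj w : extform R V := fun s => (w s)^*.

(* Number of inversions of the shuffle that lists first the positions where
   [m] is true, then those where it is false. *)
Definition shuffle_inv k (m : k.-tuple bool) : nat :=
  \sum_(i < k) \sum_(j < k | (i < j)%N) (~~ tnth m i && tnth m j).

(* On a (p,q)-homogeneous pair only the masks with p true entries contribute,
   so this is the usual sum over (p,q)-shuffles. *)
Definition wedge a w : extform R V := fun s =>
  \sum_(m : (size s).-tuple bool)
     (-1) ^+ shuffle_inv m * a (mask m s) * w (mask (map negb m) s).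

Definition bigwedge q (w : 'I_q -> extform R V) : extform R V :=
  \big[wedge/form_one]_(j < q) w j.

End Forms.

(* d w (x_0,...,x_k) =
     sum_(i < j) (-1)^(i+j) w ([x_i, x_j], x_0, ..^.. , x_i, ..^.. , x_k) *)
Definition CE_diff (R : realType) (g : lieAlgType R) (w : extform R g) : extform R g :=
  fun s => \sum_(i < size s) \sum_(j < size s | (i < j)%N)
    (-1) ^+ (i + j) *
    w (lie s`_i s`_j
        :: [seq s`_l | l <- iota 0 (size s) & (l != i :> nat) && (l != j :> nat)]).

Section Positivity.
Variables (R : realType) (V : vectType R) (J : 'End(V)).
Implicit Types (mu : V -> R[i]) (w Omega psi nu : extform R V).

Definition form10 mu : Prop :=
  (forall (a : R) x y, mu (a *: x + y) = a%:C * mu x + mu y) /\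
  (forall x, mu (J x) = 'i * mu x).

Definition basis10 n (alpha : 'I_n -> V -> R[i]) : Prop :=
  [/\ forall j, form10 (alpha j),
      forall c : 'I_n -> R[i],
        (forall x, \sum_j c j * alpha j x = 0) -> forall j, c j = 0
    & forall mu, form10 mu ->
        exists c : 'I_n -> R[i], forall x, mu x = \sum_j c j * alpha j x].

Definition pq_form (p q : nat) w : Prop :=
  exists (N : nat) (c : 'I_N -> R[i]) (mu : 'I_N -> 'I_p -> V -> R[i])
         (lambda : 'I_N -> 'I_q -> V -> R[i]),
    [/\ forall l j, form10 (mu l j), forall l j, form10 (lambda l j)
      & forall s, w s = \sum_l c l *
          wedge (bigwedge (fun j => form_of1 (mu l j)))
                (bigwedge (fun j => form_conj (form_of1 (lambda l j)))) s].

Definition real_form w : Prop := forall s, form_conj w s = w s.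

Definition volume_form (n : nat) nu : Prop :=
  exists c : R, 0 < c /\ exists alpha : 'I_n -> V -> R[i], basis10 alpha /\
    forall s, nu s = c%:C *
      bigwedge (fun j => form_scale 'i
        (wedge (form_of1 (alpha j)) (form_conj (form_of1 (alpha j))))) s.

Definition simple_form (q : nat) psi : Prop :=
  exists mu : 'I_q -> V -> R[i], (forall j, form10 (mu j)) /\
    forall s, psi s = bigwedge (fun j => form_of1 (mu j)) s.

Definition transverse (n k : nat) Omega : Prop :=
  forall psi, simple_form (n - k) psi -> (exists s, psi s != 0) ->
    volume_form n
      (form_scale ('i ^+ ((n - k) ^ 2)) (wedge (wedge Omega psi) (form_conj psi))).

End Positivity.

Definition p_Kahler (R : realType) (g : lieAlgType R) (J : 'End(g)) (p : nat) :
    Prop :=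
  exists n, [/\ \dim {:g} = n.*2, (1 <= p < n)%N &
    exists Omega : extform R g,
      [/\ pq_form J p p Omega, real_form Omega, transverse J n p Omega
        & forall s, CE_diff Omega s = 0]].

(* Main.v *)
From HB Require Import structures.
Require Import Defs.
From mathcomp Require Import all_boot all_order all_algebra.
From mathcomp Require Import complex reals boolp ring.

(** Let [x] be a nonzero vector of [a_1(J)]. Then [x] and [J x] are central and
    span a [J]-stable plane [b], so [k = g / b] inherits a bracket and a complex
    structure. Given a p-Kahler form [Om] on [g], the form
    [Om' = Om(x, J x, ...)] on [k] is (p-1)-Kahler:
    - it is basic: inserting [x] or [J x] once more gives zero;
    - it is closed, because [d] anticommutes with the contraction with a central
      vector ([contr_CE_diff]);
    - it has type (p-1,p-1), because contracting with [J x] a product of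
      (1,0)-forms already contracted with [x] gives zero, and likewise for
      (0,1)-forms ([contr_pq_term]);
    - it is transverse: if [Psi] is the pullback to [g] of a simple form on [k],
      contractions with [x] and [J x] do not see [Psi], so that
      [Om' /\ Psi /\ conj Psi] is the contraction of the volume form
      [Om /\ Psi /\ conj Psi]; and the contraction of a volume form with [x] and
      [J x] is a volume form of the quotient ([volume_form_contr]).

    Forms are functions on lists, and [wedge] is a sum over all masks, which
    amounts to a twisted Leibniz rule for the insertion of a first vector
    ([contr_wedge]). That rule determines the product by recursion on the list:
    associativity, graded commutativity and functoriality follow from it by
    induction, and the forms become an algebra over the complex numbers. To
    obtain a form on [k], the contracted form is pulled back along a
    complex-linear section of the projection ([complex_section]). *)

Set Implicit Arguments.
Unset Strict Implicit.
Unset Printing Implicit Defensive.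

Import Order.TTheory GRing.Theory Num.Theory.

Local Open Scope ring_scope.
Local Open Scope complex_scope.

(** * The exterior product as an algebra structure *)

Section WedgeAlgebra.
Variables (R : realType) (V : Type).
Implicit Types (a b c w : extform R V) (s : seq V) (x y : V).
Local Notation form := (extform R V).
Local Notation C := (R[i]).

HB.instance Definition _ := gen_eqMixin form.
HB.instance Definition _ := gen_choiceMixin form.

Fact form_addA : associative (fun a b : form => (fun s => a s + b s) : form).
Proof. by move=> a b c; apply/funext => s; rewrite addrA. Qed.
Fact form_addC : commutative (fun a b : form => (fun s => a s + b s) : form).
Proof. by move=> a b; apply/funext => s; rewrite addrC. Qed.
Fact form_add0 :
  left_id ((fun=> 0) : form) (fun a b : form => (fun s => a s + b s) : form).
Proof. by move=> a; apply/funext => s; rewrite add0r. Qed.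
Fact form_addN : left_inverse ((fun=> 0) : form)
  (fun a : form => (fun s => - a s) : form)
  (fun a b : form => (fun s => a s + b s) : form).
Proof. by move=> a; apply/funext => s; rewrite addNr. Qed.

HB.instance Definition _ := GRing.isZmodule.Build form
  form_addA form_addC form_add0 form_addN.

Lemma form_addE a b s : (a + b) s = a s + b s. Proof. by []. Qed.
Lemma form_oppE a s : (- a) s = - a s. Proof. by []. Qed.
Lemma form_zeroE s : (0 : form) s = 0. Proof. by []. Qed.

Lemma form_sumE (I : Type) (r : seq I) (P : pred I) (F : I -> form) s :
  (\sum_(i <- r | P i) F i) s = \sum_(i <- r | P i) F i s.
Proof. by elim/big_rec2: _ => // i y z _ <-. Qed.

(** The grading involution, which enters the Leibniz rule of [contr]. *)
Definition parity a : form := fun s => (-1) ^+ size s * a s.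

(** Interior product with [x]. *)
Definition contr x a : form := fun s => a (x :: s).

Lemma wedge_nil a b : wedge a b [::] = a [::] * b [::].
Proof.
rewrite /wedge (bigD1 [tuple]) //= big1; last first.
  by move=> m /eqP[]; apply: tuple0.
by rewrite addr0 /shuffle_inv big_ord0 expr0 mul1r.
Qed.

Lemma shuffle_inv_cons k e (m : k.-tuple bool) :
  shuffle_inv [tuple of e :: m] = ((~~ e) * count id m + shuffle_inv m)%N.
Proof.
rewrite /shuffle_inv big_ord_recl; congr (_ + _)%N.
  rewrite big_mkcond big_ord_recl /= add0n tnth0.
  rewrite -sum1_count big_tuple big_distrr /= [RHS]big_mkcond /=.
  by apply: eq_bigr => j _; rewrite tnthS; case: e; case: (tnth m j).
apply: eq_bigr => i _; rewrite big_mkcond big_ord_recl.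
rewrite [LHS]add0n [RHS]big_mkcond.
by apply: eq_bigr => j _; rewrite !lift0 ltnS !tnthS.
Qed.

(** A shuffle sends the first
    vector either to the left factor or, jumping over the vectors sent to the
    left, to the right one. *)
Lemma contr_wedge x a b :
  contr x (wedge a b) = wedge (contr x a) b + wedge (parity a) (contr x b).
Proof.
apply/funext => s; rewrite form_addE /contr /wedge /=.
rewrite (reindex (fun q : bool * (size s).-tuple bool => [tuple of q.1 :: q.2]));
  last first.
  exists (fun t => (thead t, [tuple of behead t])) => [[e m] _|t _] /=.
    by congr pair; apply: val_inj.
  by rewrite -tuple_eta.
rewrite -(pair_bigA _ (fun (e : bool) (m : (size s).-tuple bool) =>
   (-1) ^+ shuffle_inv [tuple of e :: m] *
   a (mask [tuple of e :: m] (x :: s)) *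
   b (mask (map negb [tuple of e :: m]) (x :: s)))) /=.
rewrite big_bool /=; congr (_ + _); apply: eq_bigr => m _.
  by rewrite shuffle_inv_cons.
rewrite shuffle_inv_cons /= mul1n /parity size_mask ?size_tuple // exprD.
by rewrite !mulrA [_ ^+ count _ _ * _]mulrC.
Qed.

Lemma wedgeDl a b c : wedge (a + b) c = wedge a c + wedge b c.
Proof.
apply/funext => s; rewrite form_addE /wedge -big_split.
by apply: eq_bigr => m _; rewrite form_addE mulrDr mulrDl.
Qed.

Lemma wedgeDr a b c : wedge a (b + c) = wedge a b + wedge a c.
Proof.
apply/funext => s; rewrite form_addE /wedge -big_split.
by apply: eq_bigr => m _; rewrite form_addE mulrDr.
Qed.

Lemma wedge0l a : wedge 0 a = 0.
Proof.
by apply/funext => s; rewrite /wedge big1 // => m _; rewrite mulr0 mul0r.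
Qed.

Lemma wedge0r a : wedge a 0 = 0.
Proof. by apply/funext => s; rewrite /wedge big1 // => m _; rewrite mulr0. Qed.

Lemma parity_contr x a : contr x (parity a) = - parity (contr x a).
Proof.
by apply/funext => s; rewrite form_oppE /contr /parity /= exprS mulN1r mulNr.
Qed.

Lemma parityD a b : parity (a + b) = parity a + parity b.
Proof. by apply/funext => s; rewrite /parity form_addE mulrDr. Qed.

Lemma parityK a : parity (parity a) = a.
Proof.
by apply/funext => s; rewrite /parity mulrA -expr2 sqrr_sign mul1r.
Qed.

Lemma wedgeNl a b : wedge (- a) b = - wedge a b.
Proof. by apply/eqP; rewrite -subr_eq0 opprK -wedgeDl addNr wedge0l. Qed.

Lemma wedgeNr a b : wedge a (- b) = - wedge a b.
Proof. by apply/eqP; rewrite -subr_eq0 opprK -wedgeDr addNr wedge0r. Qed.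

Lemma parity_wedge a b : parity (wedge a b) = wedge (parity a) (parity b).
Proof.
apply/funext => s; elim: s a b => [|x s IH] a b.
  by rewrite wedge_nil /parity wedge_nil /= !expr0 !mul1r.
rewrite -[LHS]/(contr x _ s) -[RHS]/(contr x _ s) parity_contr !contr_wedge.
by rewrite parityD form_oppE !form_addE !IH !parity_contr wedgeNl wedgeNr opprD.
Qed.

Fact wedgeA : associative (@wedge R V).
Proof.
move=> a b c; apply/funext => s; elim: s a b c => [|x s IH] a b c.
  by rewrite !wedge_nil mulrA.
rewrite -[LHS]/(contr x _ s) -[RHS]/(contr x _ s) !contr_wedge.
by rewrite wedgeDl wedgeDr !form_addE !IH parity_wedge addrA.
Qed.

Lemma contr_one x : contr x (@form_one R V) = 0.
Proof. by []. Qed.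

Lemma parity_one : parity (@form_one R V) = @form_one R V.
Proof. by apply/funext => -[|x s]; rewrite /parity ?mul1r ?mulr0. Qed.

Fact wedge1l : left_id (@form_one R V) (@wedge R V).
Proof.
move=> a; apply/funext => s; elim: s a => [|x s IH] a.
  by rewrite wedge_nil mul1r.
rewrite -[LHS]/(contr x _ s) contr_wedge contr_one wedge0l add0r parity_one.
exact: IH.
Qed.

Fact wedge1r : right_id (@form_one R V) (@wedge R V).
Proof.
move=> a; apply/funext => s; elim: s a => [|x s IH] a.
  by rewrite wedge_nil mulr1.
rewrite -[LHS]/(contr x _ s) contr_wedge contr_one wedge0r addr0; exact: IH.
Qed.

Fact form_one_neq0 : @form_one R V != 0.
Proof.
apply/eqP => /(congr1 (fun w : form => w [::])) /eqP.
by rewrite form_zeroE oner_eq0.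
Qed.

HB.instance Definition _ := GRing.Zmodule_isNzRing.Build form
  wedgeA wedge1l wedge1r wedgeDl wedgeDr form_one_neq0.

Fact form_scaleA (z t : C) a :
  form_scale z (form_scale t a) = form_scale (z * t) a.
Proof. by apply/funext => s; rewrite /form_scale mulrA. Qed.
Fact form_scale1 : left_id 1 (@form_scale R V).
Proof. by move=> a; apply/funext => s; rewrite /form_scale mul1r. Qed.
Fact form_scaleDr : right_distributive (@form_scale R V) +%R.
Proof. by move=> z a b; apply/funext => s; rewrite /form_scale mulrDr. Qed.
Fact form_scaleDl a : {morph (@form_scale R V)^~ a : z t / z + t}.
Proof. by move=> z t; apply/funext => s; rewrite /form_scale mulrDl. Qed.

HB.instance Definition _ := GRing.Zmodule_isLmodule.Build C form
  form_scaleA form_scale1 form_scaleDr form_scaleDl.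

Fact form_scaleAl (z : C) (a b : form) : z *: (a * b) = z *: a * b.
Proof.
apply/funext => s; rewrite /GRing.scale /GRing.mul /= /form_scale /wedge.
by rewrite big_distrr; apply: eq_bigr => m _ /=; rewrite !mulrA [z * _]mulrC.
Qed.

HB.instance Definition _ := GRing.Lmodule_isLalgebra.Build C form form_scaleAl.

Fact form_scaleAr (z : C) (a b : form) : z *: (a * b) = a * (z *: b).
Proof.
apply/funext => s; rewrite /GRing.scale /GRing.mul /= /form_scale /wedge.
rewrite big_distrr; apply: eq_bigr => m _ /=.
by rewrite !mulrA [z * _]mulrC -!mulrA [z * _]mulrCA.
Qed.

HB.instance Definition _ := GRing.Lalgebra_isAlgebra.Build C form form_scaleAr.

Lemma form_scaleE (z : C) a s : (z *: a) s = z * a s. Proof. by []. Qed.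
Lemma form_scale_algE z a : form_scale z a = z *: a. Proof. by []. Qed.
Lemma form_mulE a b : wedge a b = a * b. Proof. by []. Qed.
Lemma form_oneE : @form_one R V = 1. Proof. by []. Qed.

Fact contr_linear x : linear (contr x).
Proof. by []. Qed.
HB.instance Definition _ x :=
  GRing.isLinear.Build C form form *:%R (contr x) (contr_linear x).

Lemma contr_add x a b : contr x (a + b) = contr x a + contr x b.
Proof. by []. Qed.

Lemma contr_scale x (z : C) a : contr x (z *: a) = z *: contr x a.
Proof. by []. Qed.

Lemma contrM x a b : contr x (a * b) = contr x a * b + parity a * contr x b.
Proof. exact: contr_wedge. Qed.

Lemma contr1 x : contr x 1 = 0.
Proof. exact: contr_one. Qed.

Lemma parityM a b : parity (a * b) = parity a * parity b.
Proof. exact: parity_wedge. Qed.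

Lemma parityZ z a : parity (z *: a) = z *: parity a.
Proof. by apply/funext => s; rewrite /parity !form_scaleE mulrCA. Qed.

End WedgeAlgebra.

Arguments contr : simpl never.
Arguments parity : simpl never.

(** * Graded commutativity, pullback and multilinearity *)

Section Commutation.
Variables (R : realType) (V : Type).
Implicit Types (a b : extform R V).

(** The even and the odd case need each other: a contraction exchanges them. *)
Lemma parity_comm a b :
  (parity a = a -> a * b = b * a) /\
  (parity a = - a -> a * b = parity b * a).
Proof.
suff h s : (parity a = a -> (a * b) s = (b * a) s) /\
    (parity a = - a -> (a * b) s = (parity b * a) s).
  by split=> e; apply/funext => s; have [h1 h2] := h s; [apply: h1|apply: h2].
elim: s a b => [|x s IH] a b.
  rewrite -!form_mulE !wedge_nil {3}/parity expr0 mul1r.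
  by split=> _; rewrite mulrC.
split=> e; rewrite -[LHS]/(contr x _ s) -[RHS]/(contr x _ s) !contrM e.
  have odd_c : parity (contr x a) = - contr x a.
    by rewrite -{2}e parity_contr opprK.
  rewrite !form_addE; have [_ ->//] := IH (contr x a) b.
  by have [->//] := IH a (contr x b); rewrite addrC.
have even_c : parity (contr x a) = contr x a.
  by rewrite -[LHS]opprK -parity_contr e raddfN opprK.
rewrite parityK parity_contr !mulNr !form_addE !form_oppE.
have [->//] := IH (contr x a) b.
by have [_ ->//] := IH a (contr x b); rewrite addrC.
Qed.

Lemma even_comm a b : parity a = a -> a * b = b * a.
Proof. by have [] := parity_comm a b. Qed.

Lemma odd_comm a b : parity a = - a -> a * b = parity b * a.
Proof. by have [] := parity_comm a b. Qed.

Lemma contr_form_of1 x (mu : V -> R[i]) : contr x (form_of1 mu) = mu x *: 1.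
Proof.
apply/funext => -[|y s]; rewrite form_scaleE -form_oneE.
  by rewrite mulr1.
by rewrite mulr0.
Qed.

Lemma parity_form_of1 (mu : V -> R[i]) :
  parity (form_of1 mu) = - form_of1 mu.
Proof.
apply/funext => -[|y [|z s]]; rewrite /parity form_oppE /= ?mulr0 ?oppr0 //.
by rewrite expr1 mulN1r.
Qed.

Lemma form_of1_sqr (mu : V -> R[i]) : form_of1 mu * form_of1 mu = 0.
Proof.
have /eqP := odd_comm (form_of1 mu) (parity_form_of1 mu).
rewrite parity_form_of1 mulNr -subr_eq0 opprK -mulr2n -scaler_nat scaler_eq0.
by rewrite pnatr_eq0 => /eqP.
Qed.

(** Interior products are antiderivations and send 1-forms to constants. *)
Lemma contr_prod x m (mu : 'I_m.+1 -> V -> R[i]) :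
  contr x (\prod_j form_of1 (mu j)) =
  \sum_(k < m.+1) ((-1) ^+ k * mu k x) *: \prod_j form_of1 (mu (lift k j)).
Proof.
elim: m mu => [|m IH] mu.
  by rewrite !big_ord_recl !big_ord0 mulr1 addr0 mul1r contr_form_of1.
rewrite big_ord_recl contrM contr_form_of1 parity_form_of1.
rewrite [RHS]big_ord_recl expr0 mul1r -scalerAl mul1r; congr (_ + _).
rewrite IH mulNr mulr_sumr -sumrN; apply: eq_bigr => k _.
rewrite lift0 -scalerAr -scaleNr exprS mulN1r !mulNr; congr (_ *: _).
rewrite [RHS]big_ord_recl; congr (form_of1 (mu _) * _).
  exact: val_inj.
apply: eq_bigr => j _; congr (form_of1 (mu _)); apply: val_inj.
by rewrite /= /bump ltnS /=; case: leqP.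
Qed.

Lemma parity_prod m (mu : 'I_m -> V -> R[i]) :
  parity (\prod_j form_of1 (mu j)) = (-1) ^+ m *: \prod_j form_of1 (mu j).
Proof.
elim: m mu => [|m IH] mu.
  by rewrite big_ord0 scale1r; exact: parity_one.
rewrite big_ord_recl parityM IH parity_form_of1 exprS mulN1r scaleNr mulNr.
by rewrite -scalerAr.
Qed.

End Commutation.

Section Pullback.
Variables (R : realType) (V W : Type) (f : V -> W).
Local Notation formV := (extform R V).
Local Notation formW := (extform R W).
Implicit Types (a b : formW).

Definition pull a : formV := fun s => a (map f s).

Fact pull_linear : linear pull.
Proof. by []. Qed.
HB.instance Definition _ :=
  GRing.isLinear.Build R[i] formW formV *:%R pull pull_linear.

Arguments pull : simpl never.

Lemma contr_pull x a : contr x (pull a) = pull (contr (f x) a).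
Proof. by []. Qed.

Lemma parity_pull a : parity (pull a) = pull (parity a).
Proof. by apply/funext => s; rewrite /parity /pull size_map. Qed.

Fact pullM_subproof : monoid_morphism pull.
Proof.
split=> [|a b].
  by apply/funext => -[|x s].
apply/funext => s; elim: s a b => [|x s IH] a b.
  by rewrite /pull -!form_mulE !wedge_nil.
rewrite -[LHS]/(contr x _ s) -[RHS]/(contr x _ s) contr_pull !contrM raddfD.
by rewrite /= !form_addE !IH parity_pull.
Qed.
HB.instance Definition _ :=
  GRing.isMonoidMorphism.Build formW formV pull pullM_subproof.

Lemma pull_form_of1 (mu : W -> R[i]) :
  pull (form_of1 mu) = form_of1 (mu \o f).
Proof. by apply/funext => -[|x [|y s]]. Qed.

Lemma pull_scale z a : pull (z *: a) = z *: pull a.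
Proof. by []. Qed.

Lemma pull_conj a : pull (form_conj a) = form_conj (pull a).
Proof. by []. Qed.

End Pullback.

Section Multilinear.
Variables (R : realType) (V : lmodType R).
Local Notation form := (extform R V).
Implicit Types (a b w : form).

Definition real_linear (mu : V -> R[i]) : Prop :=
  forall (a : R) x y, mu (a *: x + y) = a%:C * mu x + mu y.

(** The subalgebra generated by the real-linear 1-forms: its members are
    alternating and real-multilinear, which a function on lists need not be.
    It contains the forms of type (p,q) and is stable under contractions. *)
Inductive multilinear : form -> Prop :=
| multilinear1 : multilinear 1
| multilinear_of1 mu : real_linear mu -> multilinear (form_of1 mu)
| multilinearD a b : multilinear a -> multilinear b -> multilinear (a + b)
| multilinearZ z a : multilinear a -> multilinear (z *: a)
| multilinearM a b : multilinear a -> multilinear b -> multilinear (a * b).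

Lemma multilinear0 : multilinear 0.
Proof. by rewrite -(scale0r 1); apply/multilinearZ/multilinear1. Qed.

Lemma multilinear_sum (I : Type) (r : seq I) (F : I -> form) :
  (forall i, multilinear (F i)) -> multilinear (\sum_(i <- r) F i).
Proof.
move=> h; apply: big_ind => //; first exact: multilinear0.
exact: multilinearD.
Qed.

Lemma multilinear_prod (I : Type) (r : seq I) (F : I -> form) :
  (forall i, multilinear (F i)) -> multilinear (\prod_(i <- r) F i).
Proof.
move=> h; apply: big_ind => //; first exact: multilinear1.
exact: multilinearM.
Qed.

Lemma multilinear_parity w : multilinear w -> multilinear (parity w).
Proof.
elim=> [|mu h|a b _ ha _ hb|z a _ ha|a b _ ha _ hb].
- by rewrite [parity _]parity_one; apply: multilinear1.
- by rewrite parity_form_of1 -scaleN1r; apply/multilinearZ/multilinear_of1.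
- by rewrite parityD; apply: multilinearD.
- by rewrite parityZ; apply: multilinearZ.
- by rewrite parityM; apply: multilinearM.
Qed.

Lemma multilinear_contr x w : multilinear w -> multilinear (contr x w).
Proof.
elim=> [|mu h|a b _ ha _ hb|z a _ ha|a b wa ha wb hb].
- by rewrite contr1; apply: multilinear0.
- by rewrite contr_form_of1; apply/multilinearZ/multilinear1.
- by rewrite contr_add; apply: multilinearD.
- by rewrite contr_scale; apply: multilinearZ.
- rewrite contrM; apply: multilinearD; apply: multilinearM => //.
  exact: multilinear_parity.
Qed.

Lemma contr_linearl w : multilinear w -> forall (t : R) x y,
  contr (t *: x + y) w = t%:C *: contr x w + contr y w.
Proof.
elim=> [|mu h|a b _ ha _ hb|z a _ ha|a b wa ha wb hb] t x y.
- by rewrite !contr1 scaler0 addr0.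
- by rewrite !contr_form_of1 h scalerDl scalerA.
- by rewrite !contr_add ha hb scalerDr addrACA.
- by rewrite !contr_scale ha scalerDr !scalerA [z * _]mulrC.
- rewrite !contrM ha hb mulrDl mulrDr scalerDr -scalerAl -scalerAr.
  by rewrite addrACA.
Qed.

Lemma contrD w x y : multilinear w -> contr (x + y) w = contr x w + contr y w.
Proof. by move=> /contr_linearl/(_ 1 x y); rewrite !scale1r. Qed.

Lemma contr0 w : multilinear w -> contr 0 w = 0.
Proof.
move=> mw; have /eqP := contrD 0 0 mw; rewrite addr0 -subr_eq0 opprD addrA.
by rewrite subrr sub0r oppr_eq0 => /eqP.
Qed.

Lemma contrZ w (t : R) x : multilinear w -> contr (t *: x) w = t%:C *: contr x w.
Proof.
by move=> mw; rewrite -[t *: x]addr0 (contr_linearl mw) (contr0 mw) addr0.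
Qed.

(** On 1-forms both sides vanish, and the mixed terms of the two Leibniz rules
    cancel, so alternation propagates from the generators to products. *)
Lemma contr_anticomm w : multilinear w ->
  forall x y, contr x (contr y w) = - contr y (contr x w).
Proof.
elim=> [|mu h|a b _ ha _ hb|z a _ ha|a b wa ha wb hb] x y.
- by rewrite !contr1 oppr0.
- by rewrite !contr_form_of1 !contr_scale !contr1 !scaler0 oppr0.
- by rewrite !contr_add ha hb opprD.
- by rewrite !contr_scale ha scalerN.
- rewrite !contrM !contr_add !contrM !parity_contr ha hb parityK.
  rewrite !mulrN !mulNr !opprD !opprK -!addrA; congr (_ + _).
  by rewrite addrCA !addrA.
Qed.

Lemma contr_sqr w x : multilinear w -> contr x (contr x w) = 0.
Proof.
move=> mw; have /eqP := contr_anticomm mw x x.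
rewrite -subr_eq0 opprK -mulr2n -scaler_nat scaler_eq0 pnatr_eq0.
by move=> /eqP.
Qed.

End Multilinear.

(** * Forms of type (p,q) and the Chevalley-Eilenberg differential *)

Section ComplexNumbers.
Variable R : realType.
Implicit Types z : R[i].

Lemma conj_iM z : ('i%R * z)^* = - 'i%R * z^*.
Proof. by rewrite [LHS]rmorphM; congr (_ * _); exact: conjCi. Qed.

Lemma mul_conj_gt0 z : z != 0 -> exists2 t : R, 0 < t & z * z^* = t%:C.
Proof.
case: z => a b nz; exists (a ^+ 2 + b ^+ 2); last first.
  by rewrite /=; simpc; rewrite -!expr2 [b * a]mulrC addNr.
rewrite lt0r addr_ge0 ?sqr_ge0 // andbT; apply: contra nz.
by rewrite paddr_eq0 ?sqr_ge0 // !sqrf_eq0 eq_complex.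
Qed.

End ComplexNumbers.

Section PQForms.
Variables (R : realType) (V : vectType R) (J : 'End(V)).
Local Notation form := (extform R V).
Implicit Types (w a b : form) (mu : V -> R[i]).

Definition conj_fun mu : V -> R[i] := fun x => (mu x)^*.

Lemma form_conj_of1 mu : form_conj (form_of1 mu) = form_of1 (conj_fun mu).
Proof. by apply/funext => -[|x [|y s]]; rewrite // /form_conj [LHS]rmorph0. Qed.

Lemma form10_linear mu : form10 J mu -> real_linear mu.
Proof. by case. Qed.

Lemma conj_fun_linear mu : real_linear mu -> real_linear (conj_fun mu).
Proof. move=> h t x y; rewrite /conj_fun h rmorphD rmorphM.
by congr (_ * _ + _); exact: conjc_real.
Qed.

Lemma conj_fun_J mu x : form10 J mu ->
  conj_fun mu (J x) = - 'i%R * conj_fun mu x.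
Proof. by case=> _ h; rewrite /conj_fun h; exact: conj_iM. Qed.

Definition pq_term p q (mu : 'I_p -> V -> R[i])
    (la : 'I_q -> V -> R[i]) : form :=
  (\prod_j form_of1 (mu j)) * \prod_j form_of1 (conj_fun (la j)).

Lemma pq_formE p q w : pq_form J p q w ->
  exists (N : nat) (c : 'I_N -> R[i]) (mu : 'I_N -> 'I_p -> V -> R[i])
         (la : 'I_N -> 'I_q -> V -> R[i]),
    [/\ forall l j, form10 J (mu l j), forall l j, form10 J (la l j)
      & w = \sum_l c l *: pq_term (mu l) (la l)].
Proof.
move=> [N [c [mu [la [hmu hla hw]]]]]; exists N, c, mu, la; split=> //.
apply/funext => s; rewrite hw form_sumE; apply: eq_bigr => l _.
rewrite form_scaleE /pq_term -form_mulE; congr (_ * wedge _ _ s).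
by apply: eq_bigr => j _; rewrite form_conj_of1.
Qed.

(** Any finite index type is allowed, so that the sums produced by expanding
    contractions need no renumbering. *)
Lemma pq_form_sum p q (T : finType) (c : T -> R[i])
    (mu : T -> 'I_p -> V -> R[i]) (la : T -> 'I_q -> V -> R[i]) :
  (forall t j, form10 J (mu t j)) -> (forall t j, form10 J (la t j)) ->
  pq_form J p q (\sum_t c t *: pq_term (mu t) (la t)).
Proof.
move=> hmu hla; exists #|T|, (c \o enum_val), (mu \o enum_val), (la \o enum_val).
split=> [l j|l j|s]; [exact: hmu|exact: hla|].
rewrite form_sumE (eq_bigl (mem T)) // big_enum_val; apply: eq_bigr => l _ /=.
rewrite form_scaleE /pq_term -form_mulE; congr (_ * wedge _ _ s).
by apply: eq_bigr => j _; rewrite form_conj_of1.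
Qed.

Lemma multilinear_pq_term p q (mu : 'I_p -> V -> R[i]) (la : 'I_q -> V -> R[i]) :
  (forall j, form10 J (mu j)) -> (forall j, form10 J (la j)) ->
  multilinear (pq_term mu la).
Proof.
move=> hmu hla; apply: multilinearM; apply: multilinear_prod => j.
  exact/multilinear_of1/form10_linear/hmu.
exact/multilinear_of1/conj_fun_linear/form10_linear/hla.
Qed.

Lemma pq_form_multilinear p q w : pq_form J p q w -> multilinear w.
Proof.
move/pq_formE => [N [c [mu [la [hmu hla ->]]]]]; apply: multilinear_sum => l.
exact/multilinearZ/multilinear_pq_term.
Qed.

(** On a product of (1,0)-forms, resp. (0,1)-forms, contracting with [J x]
    amounts to contracting with [x] and multiplying by [i], resp. [-i]. Hence
    contracting one of the two products with both [x] and [J x] gives zero, and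
    only the terms with one contraction in each product survive. *)
Lemma contr_pq_term p q (mu : 'I_p.+1 -> V -> R[i])
    (la : 'I_q.+1 -> V -> R[i]) x :
  (forall j, form10 J (mu j)) -> (forall j, form10 J (la j)) ->
  contr (J x) (contr x (pq_term mu la)) =
  ((-1) ^+ p.+1 * ('i%R *+ 2)) *:
    (contr x (\prod_j form_of1 (mu j)) *
     contr x (\prod_j form_of1 (conj_fun (la j)))).
Proof.
move=> hmu hla; rewrite /pq_term.
set M := \prod_j _; set L := \prod_j _.
have mM : multilinear M.
  by apply: multilinear_prod => j; exact/multilinear_of1/form10_linear/hmu.
have mL : multilinear L.
  apply: multilinear_prod => j.
  exact/multilinear_of1/conj_fun_linear/form10_linear/hla.
have JM : contr (J x) M = 'i%R *: contr x M.
  rewrite !contr_prod scaler_sumr; apply: eq_bigr => k _.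
  by rewrite (hmu k).2 scalerA mulrCA.
have JL : contr (J x) L = - 'i%R *: contr x L.
  rewrite !contr_prod scaler_sumr; apply: eq_bigr => k _.
  by rewrite scalerA conj_fun_J // mulrCA.
have JJM : contr (J x) (contr x M) = 0.
  by rewrite contr_anticomm // JM contr_scale contr_sqr // scaler0 oppr0.
have JJL : contr (J x) (contr x L) = 0.
  by rewrite contr_anticomm // JL contr_scale contr_sqr // scaler0 oppr0.
have pM : parity M = (-1) ^+ p.+1 *: M by exact: parity_prod.
rewrite contrM contr_add !contrM pM parityZ !contr_scale JJM JJL mul0r mulr0.
rewrite add0r addr0.
have -> : parity (contr x M) = - ((-1) ^+ p.+1 *: contr x M).
  by rewrite -contr_scale -pM parity_contr opprK.
rewrite JM JL scaleNr mulrN mulNr opprK.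
by rewrite -!scalerAl -!scalerAr -scalerDr -mulr2n scalerMnl scalerA.
Qed.

Lemma pq_form_contr p q w x :
  pq_form J p.+1 q.+1 w -> pq_form J p q (contr (J x) (contr x w)).
Proof.
move/pq_formE => [N [c [mu [la [hmu hla ->]]]]].
pose e l (k : 'I_p.+1 * 'I_q.+1) : R[i] := (-1) ^+ p.+1 * ('i%R *+ 2) *
  (((-1) ^+ k.1 * mu l k.1 x) * ((-1) ^+ k.2 * conj_fun (la l k.2) x)).
suff -> : contr (J x) (contr x (\sum_l c l *: pq_term (mu l) (la l))) =
    \sum_(t : 'I_N * ('I_p.+1 * 'I_q.+1))
      (c t.1 * e t.1 t.2) *: pq_term (fun j => mu t.1 (lift t.2.1 j))
                                     (fun j => la t.1 (lift t.2.2 j)).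
  by apply: pq_form_sum => t j; [apply: hmu|apply: hla].
rewrite !linear_sum -(pair_bigA _ (fun l k => (c l * e l k) *:
  pq_term (fun j => mu l (lift k.1 j)) (fun j => la l (lift k.2 j)))) /=.
apply: eq_bigr => l _; rewrite !contr_scale contr_pq_term // !contr_prod.
rewrite mulr_suml !scaler_sumr.
rewrite -(pair_bigA _ (fun k1 k2 => (c l * e l (k1, k2)) *:
  pq_term (fun j => mu l (lift k1 j)) (fun j => la l (lift k2 j)))) /=.
apply: eq_bigr => k1 _; rewrite mulr_sumr !scaler_sumr; apply: eq_bigr => k2 _.
by rewrite -scalerAl -scalerAr !scalerA !mulrA.
Qed.

End PQForms.

Section PQPullback.
Variables (R : realType) (V W : vectType R) (J : 'End(V)) (K : 'End(W)).
Variable f : V -> W.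
Hypothesis f_lin : linear f.
Hypothesis f_J : forall x, f (J x) = K (f x).

Lemma form10_pull mu : form10 K mu -> form10 J (mu \o f).
Proof. by case=> h1 h2; split=> [t x y|x] /=; rewrite ?f_lin ?h1 ?f_J ?h2. Qed.

Lemma pull_prod_of1 m (mu : 'I_m -> W -> R[i]) :
  pull f (\prod_j form_of1 (mu j)) = \prod_j form_of1 (mu j \o f).
Proof. by rewrite rmorph_prod; apply: eq_bigr => j _; apply: pull_form_of1. Qed.

Lemma pq_form_pull p q w : pq_form K p q w -> pq_form J p q (pull f w).
Proof.
move/pq_formE => [N [c [mu [la [hmu hla ->]]]]].
suff -> : pull f (\sum_l c l *: pq_term (mu l) (la l)) =
    \sum_l c l *: pq_term (fun j => mu l j \o f) (fun j => la l j \o f).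
  by apply: pq_form_sum => l j; apply: form10_pull.
rewrite linear_sum; apply: eq_bigr => l _; rewrite linearZ /=.
by rewrite /pq_term rmorphM /= !pull_prod_of1.
Qed.

End PQPullback.

Section ChevalleyEilenberg.
Variables (R : realType) (g : lieAlgType R).
Implicit Types (w : extform R g) (x y z : g).

Lemma lie0l y : lie 0 y = 0 :> g.
Proof.
by have := lie_linearl (-1) y y y; rewrite scaleN1r addNr scaleN1r addNr.
Qed.

Lemma lieC x y : lie x y = - lie y x :> g.
Proof.
have Dl u v t : lie (u + v) t = lie u t + lie v t :> g.
  by have := lie_linearl 1 u v t; rewrite !scale1r.
have Dr u v t : lie t (u + v) = lie t u + lie t v :> g.
  by have := lie_linearr 1 t u v; rewrite !scale1r.
have := liexx (x + y); rewrite Dl !Dr !liexx addr0 add0r.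
by move/eqP; rewrite addr_eq0 => /eqP.
Qed.

(** The vectors that follow the bracket in a term of [CE_diff]. *)
Definition drop_pair (T : zmodType) (s : seq T) i j : seq T :=
  [seq s`_l | l <- iota 0 (size s) & (l != i) && (l != j)].

Lemma drop_pair_cons (T : zmodType) (z : T) s i j :
  drop_pair (z :: s) i.+1 j.+1 = z :: drop_pair s i j.
Proof.
rewrite /drop_pair /=; congr cons.
by rewrite -[1%N]addn0 iotaDl filter_map -map_comp.
Qed.

(** Cartan's formula for a central vector [z]: the Lie derivative
    [contr z \o CE_diff + CE_diff \o contr z] along [z] is zero. Terms with a
    bracket of [z] vanish; in the others the sign comes from exchanging [z] with
    the bracket at the head of the list. *)
Lemma contr_CE_diff z w : (forall y, lie z y = 0) -> multilinear w ->
  contr z (CE_diff w) = - CE_diff (contr z w).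
Proof.
move=> zC mw; apply/funext => s; rewrite form_oppE /contr /CE_diff /=.
rewrite big_ord_recl big1 ?add0r; last first.
  move=> j _; rewrite [_`_(@ord0 (size s))]/= zC.
  by rewrite -[w _]/(contr 0 w _) contr0 // mulr0.
rewrite -sumrN; apply: eq_bigr => i _.
rewrite big_mkcond big_ord_recl [LHS]add0r -sumrN [RHS]big_mkcond.
apply: eq_bigr => j _; rewrite !lift0 ltnS; case: ifP => // _.
rewrite -/(drop_pair (z :: s) i.+1 j.+1) -/(drop_pair s i j) drop_pair_cons /=.
rewrite -[w [:: _, z & _]]/(contr z (contr _ w) _) contr_anticomm // form_oppE.
by rewrite addSn addnS !exprS !mulN1r opprK mulrN.
Qed.

(** [f] only has to respect brackets up to vectors whose contraction kills
    [w]: this is what lets a linear section of a Lie algebra quotient act on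
    basic forms. *)
Lemma CE_diff_pull (k : lieAlgType R) (f : k -> g) w :
  f 0 = 0 ->
  (forall x y : k, contr (f (lie x y)) w = contr (lie (f x) (f y)) w) ->
  CE_diff (pull f w) = pull f (CE_diff w).
Proof.
move=> f0 hw; apply/funext => s; rewrite /pull /CE_diff size_map.
have fnth l : (map f s)`_l = f s`_l.
  have [lt|ge] := ltnP l (size s); first exact: nth_map.
  by rewrite !nth_default ?size_map.
apply: eq_bigr => i _; apply: eq_bigr => j _; congr (_ * _).
rewrite /= !fnth -[LHS]/(contr _ w _) hw /contr; congr (w (_ :: _)).
by rewrite -map_comp; apply: eq_map => l /=; rewrite fnth.
Qed.

End ChevalleyEilenberg.

(** * Volume forms *)

(** Forms of even degree are central, so any factor can be moved to the front
    of the (noncommutative) product. *)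
Lemma prod_even_lift (R : realType) V n (w : 'I_n.+1 -> extform R V) k :
  (forall j, parity (w j) = w j) ->
  \prod_j w j = w k * \prod_j w (lift k j).
Proof.
move=> ew; elim: n w k ew => [|n IH] w k ew.
  by rewrite (ord1 k) big_ord_recl.
case: (unliftP ord0 k) => [k' ->|->]; last by rewrite big_ord_recl.
rewrite big_ord_recl (IH (w \o lift ord0) k') => [|j]; last exact: ew.
rewrite mulrA (even_comm _ (ew ord0)) -mulrA; congr (_ * _).
rewrite [RHS]big_ord_recl; congr (w _ * _); first exact: val_inj.
apply: eq_bigr => j _; congr (w _); apply: val_inj.
by rewrite /= /bump ltnS /=; case: leqP.
Qed.

Section PositiveFactors.
Variables (R : realType) (V : vectType R) (J : 'End(V)).
Implicit Types (a b : V -> R[i]).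

(** The real (1,1)-form [i a /\ conj a], a factor of a volume form. *)
Definition herm a : extform R V :=
  'i%R *: (form_of1 a * form_of1 (conj_fun a)).

Lemma form10_sub a b (t : R[i]) : form10 J a -> form10 J b ->
  form10 J (fun x => b x - t * a x).
Proof.
case=> la Ja [lb Jb]; split=> [r x y|x].
  rewrite la lb; move: (a x) (a y) (b x) (b y) r%:C => ax ay bx by' z.
  by ring.
rewrite Ja Jb; move: (a x) (b x) => ax bx.
by ring.
Qed.

Lemma parity_herm a : parity (herm a) = herm a.
Proof. by rewrite /herm parityZ parityM !parity_form_of1 mulrNN. Qed.

Lemma contr_herm x a : contr x (herm a) =
  'i%R *: (a x *: form_of1 (conj_fun a) - conj_fun a x *: form_of1 a).
Proof.
rewrite contr_scale contrM !contr_form_of1 parity_form_of1.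
by rewrite -scalerAl mul1r -scalerAr mulNr mulr1 scalerN.
Qed.

(** The value is twice the squared modulus of [a x]: this is where the
    positivity of the contracted volume form comes from. *)
Lemma contr_herm_J x a : form10 J a ->
  contr (J x) (contr x (herm a)) = (a x * conj_fun a x *+ 2) *: 1.
Proof.
move=> ha; rewrite contr_herm !(contr_scale, contr_add).
rewrite -scaleNr contr_scale !contr_form_of1 conj_fun_J // ha.2.
rewrite !scalerA -scalerDl scalerA; congr (_ *: _).
move: (a x) (conj_fun a x) => u v.
have -> : 'i%R * (u * (- 'i%R * v) + - v * ('i%R * u)) =
  - ('i%R * 'i%R) * (u * v *+ 2) by ring.
by rewrite -expr2 sqrCi opprK mul1r.
Qed.

(** The (1,1)-form of [a] absorbs multiples of [a] and of its conjugate. *)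
Lemma herm_shift a b (t : R[i]) :
  herm a * herm (fun x => b x - t * a x) = herm a * herm b.
Proof.
set A := form_of1 a; set A' := form_of1 (conj_fun a).
set B := form_of1 b; set B' := form_of1 (conj_fun b).
have BE : form_of1 (fun x => b x - t * a x) = B - t *: A.
  by apply/funext => -[|y [|z s]];
    rewrite form_addE form_oppE form_scaleE //= mulr0 subr0.
have BE' : form_of1 (conj_fun (fun x => b x - t * a x)) = B' - t^* *: A'.
  apply/funext => -[|y [|z s]];
    rewrite form_addE form_oppE form_scaleE /= ?mulr0 ?subr0 //.
  by rewrite /conj_fun rmorphB; congr (_ - _); exact: rmorphM.
have ev : parity (A * A') = A * A'.
  by rewrite parityM !parity_form_of1 mulrNN.
have kA : A * A' * A = 0.
  by rewrite even_comm // mulrA form_of1_sqr mul0r.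
have kA' : A * A' * A' = 0 by rewrite -mulrA form_of1_sqr mulr0.
rewrite /herm BE BE' -!scalerAl -!scalerAr -/A -/A' -/B -/B'.
congr (_ *: (_ *: _)).
have -> : A * A' * ((B - t *: A) * (B' - t^* *: A')) =
    A * A' * B * (B' - t^* *: A').
  by rewrite mulrA [_ * (B - _)]mulrBr -scalerAr kA scaler0 subr0.
rewrite mulrBr mulrA -scalerAr (even_comm _ ev) -!mulrA [A * (A' * A')]mulrA.
by rewrite kA' mulr0 scaler0 subr0.
Qed.

Lemma herm_prod_shift a n (b : 'I_n -> V -> R[i]) (t : 'I_n -> R[i]) :
  herm a * \prod_j herm (b j) =
  herm a * \prod_j herm (fun x => b j x - t j * a x).
Proof.
elim: n b t => [|n IH] b t; first by rewrite !big_ord0.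
rewrite !big_ord_recl !mulrA herm_shift (even_comm _ (parity_herm a)).
by rewrite -!mulrA (IH _ (fun j => t (lift ord0 j))).
Qed.

Lemma contr_prod_herm0 x n (b : 'I_n -> V -> R[i]) :
  (forall j, b j x = 0) -> contr x (\prod_j herm (b j)) = 0.
Proof.
elim: n b => [|n IH] b bx; first by rewrite big_ord0 contr1.
rewrite big_ord_recl contrM IH ?mulr0 ?addr0 // contr_herm /conj_fun bx.
by rewrite [0^*]rmorph0 !scale0r subrr scaler0 mul0r.
Qed.

Lemma volume_formE n nu : volume_form J n nu <->
  exists c : R, 0 < c /\ exists alpha : 'I_n -> V -> R[i],
    basis10 J alpha /\ nu = c%:C *: \prod_j herm (alpha j).
Proof.
have E (alpha : 'I_n -> V -> R[i]) : \prod_j herm (alpha j) =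
    bigwedge (fun j => form_scale 'i%R
      (wedge (form_of1 (alpha j)) (form_conj (form_of1 (alpha j))))).
  by apply: eq_bigr => j _; rewrite form_conj_of1.
split=> -[c [c0 [alpha [ba h]]]]; exists c; split=> //; exists alpha; split=> //.
  by apply/funext => s; rewrite h E.
by move=> s; rewrite h E.
Qed.

End PositiveFactors.

Section QuotientVolume.
Variables (R : realType) (V W : vectType R) (J : 'End(V)) (K : 'End(W)).
Variables (pr : V -> W) (sec : W -> V) (x : V).
Hypotheses (pr_lin : linear pr) (sec_lin : linear sec).
Hypothesis pr_J : forall v, pr (J v) = K (pr v).
Hypothesis sec_K : forall q, sec (K q) = J (sec q).
Hypothesis secK : cancel sec pr.
Hypothesis pr_x : pr x = 0.
Hypothesis sec_pr : forall v, exists a b : R,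
  v = sec (pr v) + (a *: x + b *: J x).

(** [v] and [sec (pr v)] differ by a combination of [x] and [J x], both killed
    by [mu]. *)
Lemma form10_descend mu v : form10 J mu -> mu x = 0 -> mu (sec (pr v)) = mu v.
Proof.
case=> lmu Jmu mx; have [a [b {2}->]] := sec_pr v.
have mu0 : mu 0 = 0.
  by have := lmu (-1) x x; rewrite scaleN1r addNr mx mulr0 addr0.
have muD u w : mu (u + w) = mu u + mu w.
  by have := lmu 1 u w; rewrite scale1r mul1r.
rewrite muD lmu -[b *: _]addr0 lmu Jmu mx mu0 !mulr0 !addr0 //.
Qed.

(** The combinations of the [alpha j] that kill [x] form a hyperplane, of which
    the corrected [alpha (lift k j)] are a basis; it is identified by [sec] with
    the space of (1,0)-forms of the quotient. *)
Lemma basis10_descend n (alpha : 'I_n.+1 -> V -> R[i]) k :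
  basis10 J alpha -> alpha k x != 0 ->
  basis10 K (fun j : 'I_n => (fun v => alpha (lift k j) v -
     alpha (lift k j) x / alpha k x * alpha k v) \o sec).
Proof.
move=> [ha hfree hspan] kx.
pose gamma j : V -> R[i] := fun v =>
  alpha (lift k j) v - alpha (lift k j) x / alpha k x * alpha k v.
have g10 j : form10 J (gamma j) by exact: form10_sub.
have gx j : gamma j x = 0 by rewrite /gamma mulfVK // subrr.
pose t := fun c : 'I_n -> R[i] =>
  - \sum_j c j * (alpha (lift k j) x / alpha k x).
have sumE (c : 'I_n -> R[i]) v :
    \sum_j c j * gamma j v = t c * alpha k v + \sum_j c j * alpha (lift k j) v.
  rewrite /t mulNr mulr_suml addrC -sumrB; apply: eq_bigr => j _.
  by rewrite /gamma mulrBr !mulrA.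
split=> [j|c c0 j|mu hmu].
- exact: (form10_pull sec_lin sec_K (g10 j)).
  (* A relation between the corrected forms is one between the [alpha j], with
     [t c] as the coefficient of [alpha k]. *)
- pose c' i := if unlift k i is Some j then c j else t c.
  have : c' (lift k j) = 0.
    apply: hfree => v; rewrite (bigD1_ord k) //= {1}/c' unlift_none.
    under eq_bigr do rewrite /c' liftK.
    rewrite -sumE -[RHS](c0 (pr v)); apply: eq_bigr => i _ /=.
    by rewrite -/(gamma i _) form10_descend.
  by rewrite /c' liftK.
  (* Evaluating at [x] shows that the coefficient of [alpha k] in the pullback
     of [mu] is [t] of the other ones. *)
- have [d hd] := hspan _ (form10_pull pr_lin pr_J hmu).
  exists (fun j => d (lift k j)) => q.
  rewrite -{1}(secK q) -[LHS]/((mu \o pr) (sec q)) hd.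
  rewrite -[RHS]/(\sum_j d (lift k j) * gamma j (sec q)) sumE.
  rewrite (bigD1_ord k) //=; congr (_ * _ + _).
  have mu0 : mu 0 = 0.
    have [l _] := hmu; have := l (-1) 0 0.
    by rewrite scaler0 addr0 rmorphN rmorph1 mulN1r addNr.
  have := hd x; rewrite /= pr_x mu0 (bigD1_ord k) //= => /esym/eqP.
  rewrite addr_eq0 => /eqP dk.
  rewrite /t; under eq_bigr do rewrite mulrA.
  by rewrite -mulr_suml -mulNr -dk mulfK.
Qed.

(** Positivity of the contraction with [x] and [J x]: choosing the basis so
    that all its members but one kill [x], the contraction only affects the
    factor of the remaining one, where it gives a positive number. *)
Lemma volume_form_contr n nu eta :
  form10 J eta -> eta x != 0 -> volume_form J n.+1 nu ->
  volume_form K n (pull sec (contr (J x) (contr x nu))).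
Proof.
move=> heta etax /volume_formE [c [c0 [alpha [ba ->]]]].
have [ha _ hspan] := ba.
have [k kx] : exists k, alpha k x != 0.
  apply/existsP; apply: contraNT etax; rewrite negb_exists => /forallP h.
  have [d ->] := hspan _ heta; apply/eqP/big1 => j _.
  by move: (h j); rewrite negbK => /eqP->; rewrite mulr0.
have [r r0 rE] := mul_conj_gt0 kx.
apply/volume_formE; exists (c * (r *+ 2)); split.
  by rewrite mulr_gt0 // pmulrn_lgt0.
eexists; split; first exact: basis10_descend ba kx.
rewrite (@prod_even_lift _ _ _ (fun j => herm (alpha j)) k) => [|j]; last first.
  exact: parity_herm.
rewrite (herm_prod_shift _ _ (fun j => alpha (lift k j) x / alpha k x)).
set G := \prod_j _.
have cG : contr x G = 0.
  by apply: contr_prod_herm0 => j; rewrite mulfVK // subrr.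
have JG : contr (J x) G = 0.
  by apply: contr_prod_herm0 => j; rewrite !(ha _).2 mulrCA mulfVK // subrr.
rewrite !contr_scale contrM cG mulr0 addr0 contrM JG mulr0 addr0.
rewrite contr_herm_J // [alpha k x * _]rE -scalerAl mul1r !pull_scale.
rewrite scalerA rmorphM rmorphMn; congr (_ *: _).
rewrite /G rmorph_prod; apply: eq_bigr => j _.
by rewrite [LHS]pull_scale rmorphM /= !pull_form_of1.
Qed.

End QuotientVolume.

(** * The quotient by a central complex line *)

Section QuotientStructures.
Variables (F : fieldType) (g : lieAlgType F) (b : {vspace g}).
Hypothesis bI : lie_ideal b.
Local Notation Q := (lie_quot bI).

(** The next term is spanned by brackets of basis vectors; bilinearity extends
    membership to all brackets. *)
Lemma lie_mem_lower_central (x y : g) k :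
  x \in lower_central g k -> lie x y \in lower_central g k.+1.
Proof.
rewrite {2}/lower_central iterS -/(lower_central g k).
set S := (<<_>>)%VS => xU.
have mem_basis (i : 'I_(\dim (lower_central g k))) z :
    lie (vbasis (lower_central g k))`_i z \in S.
  rewrite (coord_vbasis (memvf z)).
  elim/big_rec: _ => [|j t _ tS].
    have h := lie_linearr (-1) (vbasis (lower_central g k))`_i 0 0.
    by move: h; rewrite scaler0 addr0 scaleN1r addNr => ->; exact: mem0v.
  rewrite lie_linearr rpredD // rpredZ //; apply: memv_span.
  by apply: allpairs_f; apply: mem_nth; rewrite size_tuple.
rewrite (coord_vbasis xU); elim/big_rec: _ => [|j t _ tS].
  have h := lie_linearl (-1) 0 0 y.
  by move: h; rewrite scaler0 addr0 scaleN1r addNr => ->; exact: mem0v.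
by rewrite lie_linearl rpredD // rpredZ.
Qed.

Lemma lower_central_quot k :
  (lower_central Q k <= linfun (@lie_pi F g b bI) @: lower_central g k)%VS.
Proof.
have pi_img (v : g) (U : {vspace g}) :
    v \in U -> lie_pi bI v \in (linfun (@lie_pi F g b bI) @: U)%VS.
  by move=> vU; rewrite -(lfunE (@lie_pi F g b bI)); apply: memv_img.
elim: k => [|k IH].
  by apply/subvP => q _; have [v ->] := lie_pi_surj q; apply/pi_img/memvf.
apply/span_subvP => q /allpairsP [[q1 q2] /= [q1U _ ->]].
have /memv_imgP [v1 v1U] := subvP IH _ (vbasis_mem q1U).
rewrite lfunE /= => ->; have [v2 ->] := lie_pi_surj q2.
rewrite [lie _ _]quot_lie_pi; apply: pi_img.
exact: lie_mem_lower_central.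
Qed.

Lemma lie_nilpotent_quot : lie_nilpotent g -> lie_nilpotent Q.
Proof.
move=> [k gk]; exists k; apply/eqP; rewrite -subv0.
by apply: subv_trans (lower_central_quot k) _; rewrite gk limg0.
Qed.

Lemma dim_lie_quot : \dim {:g} = (\dim b + \dim {:Q})%N.
Proof.
rewrite -(limg_ker_dim (linfun (@lie_pi F g b bI)) fullv) capfv.
congr (_ + _)%N; congr (\dim _).
  apply/vspaceP => v; rewrite memv_ker lfunE /=; exact: lie_pi_ker.
apply/vspaceP => q; rewrite memvf; have [v ->] := lie_pi_surj q.
by rewrite -(lfunE (@lie_pi F g b bI)) memv_img ?memvf.
Qed.

Lemma complex_structure_quot (J : 'End(g)) :
  (J @: b <= b)%VS -> complex_structure J ->
  complex_structure (quot_end bI J).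
Proof.
move=> Jb [JJ NJ]; split=> [q|q r].
  by have [v ->] := lie_pi_surj q; rewrite !quot_endE // JJ linearN.
have [v ->] := lie_pi_surj q; have [w ->] := lie_pi_surj r.
have pi_lie s t : lie (lie_pi bI s) (lie_pi bI t) = lie_pi bI (lie s t).
  exact: quot_lie_pi.
have pi_J u : quot_end bI J (lie_pi bI u) = lie_pi bI (J u) by exact: quot_endE.
rewrite /nijenhuis (pi_J v) (pi_J w) !pi_lie.
rewrite (pi_J (lie (J v) w)) (pi_J (lie v (J w))).
by rewrite -!linearB -[LHS]/(lie_pi bI (nijenhuis J v w)) NJ linear0.
Qed.

End QuotientStructures.

Section JPlane.
Variables (R : realType) (V : vectType R) (J : 'End(V)) (x : V).
Hypotheses (JJ : forall v, J (J v) = - v) (x0 : x != 0).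

Definition J_plane : {vspace V} := <<[:: x; J x]>>.

(** If [x = c J x], then [J x = - c x], hence [(1 + c^2) x = 0]. *)
Lemma J_plane_free : free [:: x; J x].
Proof.
have Jx0 : J x != 0.
  by apply: contra x0 => /eqP h; rewrite -oppr_eq0 -JJ h linear0.
rewrite free_cons seq1_free Jx0 andbT span_seq1; apply/vlineP => -[c xE].
have : (1 + c ^+ 2) *: x = 0.
  have JxE : J x = - (c *: x) by rewrite {1}xE linearZ /= JJ scalerN.
  by rewrite scalerDl scale1r {1}xE JxE scalerN scalerA -expr2 addNr.
move/eqP; rewrite scaler_eq0 (negPf x0) orbF => /eqP h.
have : 0 < 1 + c ^+ 2 by rewrite ltr_pwDl ?ltr01 ?sqr_ge0.
by rewrite h ltxx.
Qed.

Lemma dim_J_plane : \dim J_plane = 2%N.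
Proof. exact/eqP/J_plane_free. Qed.

Lemma J_planeP v :
  reflect (exists a c : R, v = a *: x + c *: J x) (v \in J_plane).
Proof.
rewrite /J_plane span_cons span_seq1.
apply: (iffP memv_addP) => [[u /vlineP [a ->] [w /vlineP [c ->] ->]]|[a [c ->]]].
  by exists a, c.
exists (a *: x); first by rewrite memvZ ?memv_line.
by exists (c *: J x); rewrite ?memvZ ?memv_line.
Qed.

Lemma J_plane_stable : (J @: J_plane <= J_plane)%VS.
Proof.
apply/subvP => v /memv_imgP [u /J_planeP [a [c ->]] ->]; apply/J_planeP.
by exists (- c), a; rewrite linearD !linearZ /= JJ scalerN scaleNr addrC.
Qed.

(** A functional that is the real part on [J_plane] of a (1,0)-form with value
    1 at [x]. *)
Lemma J_plane_coordinate : exists f : V -> R,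
  [/\ forall a u v, f (a *: u + v) = a * f u + f v, f x = 1 & f (J x) = 0].
Proof.
pose X := [tuple x; J x].
have fX : free X by exact: J_plane_free.
pose f v := coord X ord0 (projv J_plane v).
have fE (i : 'I_2) : f X`_i = (i == ord0)%:R.
  rewrite /f projv_id; first by rewrite coord_free // eq_sym.
  by apply: memv_span; apply: mem_nth; rewrite size_tuple.
exists f; split; [|exact: (fE ord0)|exact: (fE ord_max)].
by move=> a u v; rewrite /f !linearP.
Qed.

End JPlane.

Section PKahlerQuotient.
Variables (R : realType) (g : lieAlgType R) (J : 'End(g)) (x : g).
Hypotheses (JJ : forall v, J (J v) = - v) (x0 : x != 0).
Hypotheses (x_central : forall y, lie x y = 0).
Hypotheses (Jx_central : forall y, lie (J x) y = 0).
Local Notation b := (J_plane J x).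

Lemma J_plane_central v y : v \in b -> lie v y = 0.
Proof.
case/J_planeP => [a [c ->]]; rewrite lie_linearl x_central scaler0 add0r.
by rewrite -[c *: J x]addr0 lie_linearl Jx_central scaler0 add0r lie0l.
Qed.

Lemma J_plane_ideal : lie_ideal b.
Proof. by move=> u v vb; rewrite lieC J_plane_central // oppr0 mem0v. Qed.

Variable bI : lie_ideal b.
Local Notation Q := (lie_quot bI).
Local Notation pr := (lie_pi bI).
Local Notation K := (quot_end bI J).

Lemma quot_end_pi v : K (pr v) = pr (J v).
Proof. exact/quot_endE/J_plane_stable. Qed.

(** The kernel of a (1,0)-form that does not vanish at [x] is a complement of
    the plane that is stable under [J], and so yields a complex-linear
    section. *)
Lemma complex_section : exists (sec : Q -> g) (eta : g -> R[i]),
  [/\ linear sec, forall q, sec (K q) = J (sec q), cancel sec pr,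
      forall v, exists s t : R, v = sec (pr v) + (s *: x + t *: J x)
    & form10 J eta /\ eta x != 0].
Proof.
have [f [fL fx fJx]] := J_plane_coordinate JJ x0.
have f0 : f 0 = 0.
  by have := fL (-1) 0 0; rewrite scaler0 addr0 mulN1r addNr.
have fZ a v : f (a *: v) = a * f v by rewrite -[a *: v]addr0 fL f0 addr0.
have fD u v : f (u + v) = f u + f v by rewrite -[u]scale1r fL mul1r scale1r.
have fN v : f (- v) = - f v by rewrite -scaleN1r fZ mulN1r.
(* [f - i (f \o J)] is a (1,0)-form with value 1 at [x], and [P] is the
   projection onto its kernel along the plane: [f] and [- (f \o J)] are its real
   and imaginary parts. *)
pose P v := v - (f v *: x - f (J v) *: J x).
have PL : linear P.
  move=> a u v; rewrite /P [J _]linearP !fL !scalerDl -!scalerA.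
  have subACA (p q r s : g) : p + q - (r + s) = p - r + (q - s).
    by rewrite opprD addrACA.
  by rewrite 2!scalerBr [X in _ - X = _]subACA subACA.
have PJ v : P (J v) = J (P v).
  have -> : J (P v) = J v - (f v *: J x - f (J v) *: J (J x)).
    by rewrite /P 2!linearB !linearZ.
  by rewrite /P !JJ fN scaleNr scalerN !opprK [_ *: x + _]addrC.
have P0 : P 0 = 0 by rewrite /P linear0 f0 !scale0r !subr0.
have Px : P x = 0 by rewrite /P fx fJx scale1r scale0r subr0 subrr.
have Pb v : v \in b -> P v = 0.
  case/J_planeP => [a [c ->]]; rewrite PL Px scaler0 add0r.
  by rewrite -[c *: J x]addr0 PL PJ Px linear0 scaler0 add0r P0.
have PN v : P (- v) = - P v by have := PL (-1) v 0; rewrite P0 !addr0 !scaleN1r.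
have PB u v : P (u - v) = P u - P v.
  by have := PL 1 u (- v); rewrite !scale1r PN.
pose sec (q : Q) := P (repr (q : Quotient.quot b)).
have secE v : sec (pr v) = P v.
  by apply/eqP; rewrite -subr_eq0 /sec -PB Pb ?eqxx //; exact: lie_pi_repr.
exists sec, (fun v => (f v)%:C - 'i%R * (f (J v))%:C); split.
- move=> a q r; have [u ->] := lie_pi_surj q; have [v ->] := lie_pi_surj r.
  by rewrite -linearP !secE PL.
- by move=> q; have [u ->] := lie_pi_surj q; rewrite quot_end_pi !secE PJ.
- move=> q; have [u ->] := lie_pi_surj q; rewrite secE; apply/lie_pi_eq.
  rewrite /P addrAC subrr sub0r rpredN; apply/J_planeP.
  by exists (f u), (- f (J u)); rewrite scaleNr.
- move=> v; exists (f v), (- f (J v)).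
  by rewrite secE /P scaleNr subrK.
split; last by rewrite fx fJx mulr0 subr0 oner_eq0.
split=> [a u v|v].
  rewrite linearD linearZ /= !fD !fZ !rmorphD !rmorphM /=.
  by ring.
rewrite JJ fN rmorphN /=.
have ii : 'i%R * 'i%R = -1 :> R[i] by rewrite -expr2 sqrCi.
rewrite mulrBr mulrA ii mulrN mulN1r !opprK addrC //.
Qed.

(** The new form is the contraction of the given one with [x] and [J x],
    restricted to the image of the section. *)
Lemma p_Kahler_quot p :
  (1 <= p)%N -> p_Kahler J p.+1 -> p_Kahler K p.
Proof.
move=> p1 [n [dimg /andP [_]]]; case: n dimg => // n dimg pn.
move=> [Om [pqOm reOm trOm dOm]].
have [sec [eta [secL secJ secK sec_pr [eta10 etax]]]] := complex_section.
have prL : linear pr by exact: linearP.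
have prJ v : pr (J v) = K (pr v) by rewrite quot_end_pi.
have prx : pr x = 0.
  apply/eqP; rewrite lie_pi_ker; apply/J_planeP.
  by exists 1, 0; rewrite scale1r scale0r addr0.
have prJx : pr (J x) = 0 by rewrite prJ prx linear0.
have mOm := pq_form_multilinear pqOm.
exists n; split.
- apply/eqP; rewrite -(eqn_add2l 2) -{1}(dim_J_plane JJ x0) -dim_lie_quot.
  by rewrite dimg.
- by rewrite p1.
exists (pull sec (contr (J x) (contr x Om))); split.
- exact: (pq_form_pull secL secJ (pq_form_contr x pqOm)).
- by move=> s; exact: reOm.
- move=> psi [mu [mu10 psiE]] [s0 psi0].
  (* Transversality of [Om] is applied to the pullback of [psi], which the
     contractions with [x] and [J x] do not see. *)
  have psiP : psi = \prod_j form_of1 (mu j) by apply/funext => s; rewrite psiE.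
  pose Psi := pull pr psi.
  have mpsi : multilinear psi.
    rewrite psiP; apply: multilinear_prod => j.
    exact/multilinear_of1/form10_linear/mu10.
  have secPsi : pull sec Psi = psi.
    by apply/funext => s; rewrite /Psi /pull -map_comp (eq_map secK) map_id.
  have kill v : pr v = 0 -> contr v Psi = 0.
    by move=> pv; rewrite contr_pull pv contr0 // raddf0.
  have killc v : pr v = 0 -> contr v (form_conj Psi) = 0.
    move=> pv; rewrite -[contr v _]/(form_conj (contr v Psi)) kill //.
    by apply/funext => s; exact: rmorph0.
  have vol : volume_form J n.+1 (form_scale ('i%R ^+ ((n - p) ^ 2))
      (wedge (wedge Om Psi) (form_conj Psi))).
    rewrite /transverse subSS in trOm; apply: trOm.
      exists (fun j => mu j \o pr); split=> [j|s].
        exact: (form10_pull prL prJ (mu10 j)).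
      by rewrite /Psi psiP pull_prod_of1.
    by exists (map sec s0); rewrite -[Psi _]/(pull sec Psi s0) secPsi.
  have := volume_form_contr prL secL prJ secJ secK prx sec_pr eta10 etax vol.
  congr (volume_form _ _ _).
  rewrite !form_scale_algE !form_mulE (contr_scale x) (contr_scale (J x)).
  rewrite pull_scale.
  rewrite !contrM !(kill x) // !(killc x) // !mulr0 !addr0.
  rewrite !contrM !(kill (J x)) // !(killc (J x)) // !mulr0 !addr0.
  by rewrite !rmorphM /= pull_conj secPsi.
have dOm0 : CE_diff Om = 0 by apply/funext.
have d1 : CE_diff (contr x Om) = 0.
  by rewrite -[LHS]opprK -contr_CE_diff // dOm0 oppr0.
have d2 : CE_diff (contr (J x) (contr x Om)) = 0.
  rewrite -[LHS]opprK -contr_CE_diff //; first by rewrite d1 oppr0.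
  exact: multilinear_contr.
have m2 := multilinear_contr (J x) (multilinear_contr x mOm).
move=> s; rewrite CE_diff_pull ?d2 //.
  by have := secL (-1) 0 0; rewrite scaler0 addr0 scaleN1r addNr.
move=> q r; have [u ->] := lie_pi_surj q; have [v ->] := lie_pi_surj r.
rewrite [lie (pr u) _]quot_lie_pi.
have [s1 [t1 uE]] := sec_pr u; have [s2 [t2 vE]] := sec_pr v.
have [s3 [t3 uvE]] := sec_pr (lie u v).
(* The section is a Lie morphism up to central vectors of the plane, which
   are killed because the form is already contracted with [x] and [J x]. *)
have bC s' t' y : lie (s' *: x + t' *: J x) y = 0.
  by apply: J_plane_central; apply/J_planeP; exists s', t'.
have lieDl p' q' y : lie (p' + q') y = lie p' y + lie q' y :> g.
  by have := lie_linearl 1 p' q' y; rewrite !scale1r.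
have -> : lie (sec (pr u)) (sec (pr v)) =
    sec (pr (lie u v)) + (s3 *: x + t3 *: J x).
  rewrite -uvE {2}uE lieDl bC addr0 [RHS]lieC {2}vE lieDl bC addr0 -lieC //.
have kx : contr x (contr (J x) (contr x Om)) = 0.
  rewrite contr_anticomm; last exact: multilinear_contr.
  by rewrite contr_sqr // !raddf0.
have kJx : contr (J x) (contr (J x) (contr x Om)) = 0.
  by rewrite contr_sqr //; exact: multilinear_contr.
rewrite contrD // contr_linearl // contrZ // kx kJx !scaler0 !addr0 //.
Qed.
End PKahlerQuotient.

(** * Reduction of p-Kahler structures *)

Local Close Scope complex_scope.
Local Close Scope ring_scope.

Theorem proposition3p3 (R : realType) (g : lieAlgType R) (n p : nat)
    (J : 'End(g)) :
  \dim {:g} = n.*2 -> (6 <= n.*2)%N ->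
  lie_nilpotent g -> complex_structure J -> quasi_nilpotent J ->
  (2 <= p < n)%N ->
  p_Kahler J p ->
  exists (b : {vspace g}) (k : lieAlgType R) (K : 'End(k)),
    [/\ \dim b = 2 /\ (J @: b <= b)%VS,
        lie_nilpotent k, complex_structure K,
        \dim {:k} = (n - 1).*2 /\ p_Kahler K (p - 1)
      & b_extension J b K].
Proof.
move=> dimg n3 nilg [JJ NJ] qn /andP [p2 pn] pK.
have [x xa /eqP x0] := qn.
have xC y : lie x y = 0%R by have [] := xa y.
have JxC y : lie (J x) y = 0%R by have [] := xa y.
pose bI := J_plane_ideal xC JxC.
have Jb := J_plane_stable x JJ.
have dimb := dim_J_plane JJ x0.
have nilk : lie_nilpotent (lie_quot bI) := lie_nilpotent_quot bI nilg.
have Kc : complex_structure (quot_end bI J).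
  by apply: complex_structure_quot.
have dimk : \dim {: lie_quot bI} = (n - 1).*2.
  by rewrite doubleB -dimg (dim_lie_quot bI) dimb addKn.
exists (J_plane J x), (lie_quot bI : lieAlgType R), (quot_end bI J).
split=> //.
  split=> //; apply: (p_Kahler_quot JJ x0 xC JxC).
    by rewrite subn_gt0.
  by rewrite subn1 prednK // ltnW.
split=> //.
- split=> // v vb y; split.
    exact: J_plane_central.
  by apply: J_plane_central => //; exact/(subvP Jb)/memv_img.
- by split=> //; exists n.
- exists bI, \1%VF; split=> [|u v|u]; rewrite ?id_lfunE //.
  by exists id => u; rewrite id_lfunE.
Qed.
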